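(* In the setting of the context (oriented Fano plane of type $(0,1,3)$, canonical composition factor $\epsilon$, operators $X_{P,D}\in\mathrm{End}(\mathbb O_{\cal F})$, bracket the commutator), let $(P,D)$ and $(P',D')$ be incident point–line pairs. Then: (1) if $P=P'$ and $D\neq D'$, then $[X_{P,D},X_{P,D'}]=0$; (2) if $P\neq P'$ and $D=D'$, then $[X_{P,D},X_{P',D}]=2\epsilon_{PP'}X_{P+P',P\wedge P'}$; (3) if $P\neq P'$, $D\neq D'$ and ($P\in D'$ or $P'\in D$), then $[X_{P,D},X_{P',D'}]=-\epsilon_{PP'}X_{P+P',P\wedge P'}$; (4) if $P\neq P'$, $D\neq D'$, $P\notin D'$ and $P'\notin D$, then $[X_{P,D},X_{P',D'}]=-\epsilon_{PP'}X_{P+P',D+D'}$, where $D+D'$ denotes the third line passing through the point $D\cap D'$.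
   Context: $\mathbb F$ is a field of characteristic not $2$. ${\cal F}$ is a Fano plane (seven points, seven lines), $P+Q$ denotes the third point on the line through distinct points $P,Q$, and $P\wedge Q$ the line through them. $\tau$ is an automorphism of ${\cal F}$ of order seven such that, writing $P_i=\tau^i(P_0)$ for $i\in\mathbb Z_7$, the lines are exactly $D_i=\{P_i,P_{i+1},P_{i+3}\}$, $i\in\mathbb Z_7$ (type $(0,1,3)$). The canonical composition factor is $\epsilon_{P_iP_j}=1$ if $j-i\equiv1,2,4\pmod 7$ and $-1$ if $j-i\equiv3,5,6\pmod 7$. $\mathbb O_{\cal F}$ is the $\mathbb F$-algebra with basis $1,e_{P}$ ($P\in{\cal F}$), unit $1$, $e_Pe_Q=\epsilon_{PQ}e_{P+Q}$ for $P\ne Q$, $e_Pe_P=-1$. For $x\in\mathbb O_{\cal F}$ let $L_x$ be left multiplication by $x$, and for distinct $P,Q$ set $e_{P,Q}=\tfrac14(L_{e_P}L_{e_Q}-L_{e_Q}L_{e_P})\in\mathrm{End}(\mathbb O_{\cal F})$. The three lines through $P_i$ are $D_i$, $D_{i-1}=\{P_{i-1},P_i,P_{i+2}\}$, $D_{i-3}=\{P_{i-3},P_{i-2},P_i\}$, and one defines $X_{P_i,D_i}=e_{P_{i+2},P_{i-1}}-e_{P_{i-3},P_{i-2}}$, $X_{P_i,D_{i-1}}=e_{P_{i-3},P_{i-2}}-e_{P_{i+1},P_{i+3}}$, $X_{P_i,D_{i-3}}=e_{P_{i+1},P_{i+3}}-e_{P_{i+2},P_{i-1}}$. Brackets are commutators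 in $\mathrm{End}(\mathbb O_{\cal F})$. An incident pair $(P,D)$ means a point $P$ and a line $D$ with $P\in D$. *)

(* Defs.v *)
From HB Require Import structures.
From mathcomp Require Import all_boot all_order all_fingroup all_algebra.

Set Implicit Arguments.
Unset Strict Implicit.
Unset Printing Implicit Defensive.

Import GRing.Theory.
Local Open Scope ring_scope.

Section FanoPlane.

Variables (T : finType) (lines : {set {set T}}).

Definition fano_plane : Prop :=
  [/\ #|T| = 7%N, #|lines| = 7%N,
      forall D, D \in lines -> #|D| = 3%N
    & forall P Q : T, P != Q ->
        exists! D : {set T}, [/\ D \in lines, P \in D & Q \in D] ].

Definition fano_automorphism (tau : {perm T}) : Prop :=
  forall D : {set T}, (tau @: D \in lines) = (D \in lines).

Definition incident (P : T) (D : {set T}) : bool := (D \in lines) && (P \in D).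

(* The line through P and Q; meaningful only for P != Q, as is [third_point]. *)
Definition line_through (P Q : T) : {set T} :=
  odflt set0 [pick D in lines | (P \in D) && (Q \in D)].

Definition third_point (P Q : T) : T :=
  odflt P [pick R in line_through P Q | (R != P) && (R != Q)].

(* Meaningful only for distinct lines D and D', whose intersection D :&: D' is
   a singleton. *)
Definition third_line (D D' : {set T}) : {set T} :=
  odflt set0 [pick E in lines | [&& E != D, E != D' & D :&: D' \subset E]].

End FanoPlane.

Section Orientation.

Variables (T : finType) (tau : {perm T}) (P0 : T).

Definition pt (i : 'Z_7) : T := ((tau ^+ i)%g) P0.

Definition ln (i : 'Z_7) : {set T} := [set pt i; pt (i + 1); pt (i + 3)].

(* The inverse of [pt] when the latter is bijective. *)
Definition idx (P : T) : 'Z_7 := odflt 0 [pick i | pt i == P].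

(* For P != Q, the index difference is 3, 5 or 6 in the second case. *)
Definition eps (F : fieldType) (P Q : T) : F :=
  if idx Q - idx P \in [:: 1; 2; 4] then 1 else -1.

End Orientation.

(* Coordinates on the basis 1, e_P: the index [None] stands for 1 and
   [Some P] for e_P. *)
Definition octonion (F : fieldType) (T : finType) := {ffun option T -> F^o}.

HB.instance Definition _ (F : fieldType) (T : finType) :=
  Vector.on (octonion F T).

Section Octonions.

Variables (F : fieldType) (T : finType).
Variables (lines : {set {set T}}) (tau : {perm T}) (P0 : T).

Local Notation OF := (octonion F T).
Local Notation pt := (pt tau P0).
Local Notation ln := (ln tau P0).

Definition oct_basis (a : option T) : OF := [ffun b => (a == b)%:R].

Definition oct1 : OF := oct_basis None.

Definition oct_e (P : T) : OF := oct_basis (Some P).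

Definition oct_basis_mul (a b : option T) : OF :=
  match a, b with
  | None, _ => oct_basis b
  | _, None => oct_basis a
  | Some P, Some Q =>
      if P == Q then - oct1
      else eps tau P0 F P Q *: oct_e (third_point lines P Q)
  end.

Definition oct_mul (x y : OF) : OF :=
  \sum_a \sum_b (x a * y b) *: oct_basis_mul a b.

Fact oct_mul_linear (x : OF) : linear (oct_mul x).
Proof.
move=> k y z; rewrite /oct_mul scaler_sumr -big_split; apply: eq_bigr => a _.
rewrite scaler_sumr -big_split; apply: eq_bigr => b _ /=.
by rewrite !ffunE scalerA -scalerDl mulrDr mulrCA.
Qed.

HB.instance Definition _ (x : OF) :=
  GRing.isLinear.Build F OF OF _ (oct_mul x) (oct_mul_linear x).

Lemma oct_mul_basis a b :
  oct_mul (oct_basis a) (oct_basis b) = oct_basis_mul a b.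
Proof.
rewrite /oct_mul (bigD1 a) //= [X in _ + X]big1 ?addr0 => [|c /negPf ca].
  rewrite (bigD1 b) //= [X in _ + X]big1 ?addr0 => [|c /negPf cb].
    by rewrite !ffunE !eqxx mulr1 scale1r.
  by rewrite !ffunE [b == c]eq_sym cb mulr0 scale0r.
by apply: big1 => d _; rewrite !ffunE [a == c]eq_sym ca mul0r scale0r.
Qed.

Definition lmult (x : OF) : 'End(OF) := linfun (oct_mul x).

Lemma lmultE x y : lmult x y = oct_mul x y.
Proof. exact: lfunE. Qed.

(* Composition is used instead of the ring product on 'End(_), since the latter
   (from falgebra) composes in the opposite order. *)
Definition lie_bracket (f g : 'End(OF)) : 'End(OF) := ((f \o g) - (g \o f))%VF.

Lemma lie_bracketE f g x : lie_bracket f g x = f (g x) - g (f x).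
Proof. by rewrite /lie_bracket add_lfunE opp_lfunE !comp_lfunE. Qed.

Definition e2 (P Q : T) : 'End(OF) :=
  (4%:R : F)^-1 *: lie_bracket (lmult (oct_e P)) (lmult (oct_e Q)).

Definition X_op (P : T) (D : {set T}) : 'End(OF) :=
  let i := idx tau P0 P in
  if D == ln i then
    e2 (pt (i + 2)) (pt (i - 1)) - e2 (pt (i - 3)) (pt (i - 2))
  else if D == ln (i - 1) then
    e2 (pt (i - 3)) (pt (i - 2)) - e2 (pt (i + 1)) (pt (i + 3))
  else if D == ln (i - 3) then
    e2 (pt (i + 1)) (pt (i + 3)) - e2 (pt (i + 2)) (pt (i - 1))
  else 0.

End Octonions.

(* Main.v *)
(**
The left multiplications L_i by e_{P_i} satisfy the Clifford relations
L_i L_j + L_j L_i = -2 delta_ij, so the operators e_{P_i,P_j} satisfy the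
commutation relations of so(7).  Each X_{P,D} is a difference of two of them,
and every identity of the theorem already holds at the level of formal integral
combinations of pairs (i, j), modulo (i, j) = -(j, i).  Re-indexing L by a
translation of Z/7 preserves the Clifford relations, which reduces these
identities to the case P = P_0, a finite computation.
*)
Require Import Defs.
From mathcomp Require Import all_boot all_order all_fingroup all_algebra.

Set Implicit Arguments.
Unset Strict Implicit.
Unset Printing Implicit Defensive.

Import GRing.Theory.
Local Open Scope ring_scope.

(** * Finite computations with indices in Z/7 *)

Definition Z7 : seq 'Z_7 := [:: 0; 1; 2; 3; 4; 5; 6].

Lemma all_Z7P (p : pred 'Z_7) : reflect (forall i, p i) (all p Z7).
Proof.
apply: (iffP allP) => [pP i|pP i _]; last exact: pP.
by apply: pP; case: i => [] [|[|[|[|[|[|[|i]]]]]]] lti7.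
Qed.

(* The point [pt i] lies on [ln j] iff [i - j] is one of these. *)
Definition line_offsets : seq 'Z_7 := [:: 0; 1; 3].

(* Offsets relative to [pt i]: for [a != 0], the line through [pt i] and
   [pt (i + a)] is [ln (i + join a)] and its third point is [pt (i + third a)]. *)
Definition third (a : 'Z_7) : 'Z_7 :=
  if a \in [:: 1; 2; 4] then 3 * a else 5 * a.

Definition join (a : 'Z_7) : 'Z_7 := nth 0 [:: 0; 0; -1; 0; -3; -3; -1] a.

Definition sgn (a : 'Z_7) : int := if a \in [:: 1; 2; 4] then 1 else -1.

(* A signed basis vector: [(c, None)] stands for [c] times 1 and [(c, Some j)]
   for [c] times [e_{P_j}]. *)
Definition emul (i : 'Z_7) (a : int * option 'Z_7) : int * option 'Z_7 :=
  if a.2 is Some j then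
    if i == j then (- a.1, None)
    else (a.1 * sgn (j - i), Some (i + third (j - i)))
  else (a.1, Some i).

(* The term [(c, (i, j))] stands for [c] times [e_{P_i, P_j}]. *)
Definition lin_comb : Type := seq (int * ('Z_7 * 'Z_7)).

Definition scale_comb (c : int) (s : lin_comb) : lin_comb :=
  [seq (c * t.1, t.2) | t <- s].

(** The four terms of the so(7) relation proved as [spin_comm]; those with a vanishing Kronecker
    delta are kept with coefficient 0. *)
Definition comm_term (t u : int * ('Z_7 * 'Z_7)) : lin_comb :=
  let c := t.1 * u.1 in
  let: (a, b) := t.2 in let: (d, e) := u.2 in
  [:: (c * (a == d)%:Z, (b, e)); (- c * (b == d)%:Z, (a, e));
      (c * (a == e)%:Z, (d, b)); (- c * (b == e)%:Z, (d, a))].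

Definition comm_comb (s t : lin_comb) : lin_comb :=
  flatten [seq comm_term x y | x <- s, y <- t].

(* Antisymmetrized, because the pairs (i, j) and (j, i) stand for opposite
   operators. *)
Definition coef (s : lin_comb) (i j : 'Z_7) : int :=
  foldr (fun t c =>
    t.1 * ((t.2 == (i, j))%:Z - ((t.2.2, t.2.1) == (i, j))%:Z) + c) 0 s.

Definition eq_comb (s t : lin_comb) : bool :=
  all (fun i => all (fun j => coef s i j == coef t i j) Z7) Z7.

Definition X_comb (i j : 'Z_7) : lin_comb :=
  if j == i then [:: (1, (i + 2, i - 1)); (-1, (i - 3, i - 2))]
  else if j == i - 1 then [:: (1, (i - 3, i - 2)); (-1, (i + 1, i + 3))]
  else if j == i - 3 then [:: (1, (i + 1, i + 3)); (-1, (i + 2, i - 1))]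
  else [::].

(** Each product of basis vectors is a single signed basis vector, so the Clifford relation means
    equal positions with opposite signs, or, for [i = j], that multiplying twice gives -1. *)
Definition emul_anticomm (i j : 'Z_7) (a : option 'Z_7) : bool :=
  let u := emul i (emul j (1, a)) in
  let v := emul j (emul i (1, a)) in
  (u.2 == v.2) && (if i == j then (u == (-1, a)) else u.1 == - v.1).

Lemma emul_anticommP i j a : emul_anticomm i j a.
Proof.
have: all (fun i => all (fun j => emul_anticomm i j None &&
    all (fun a => emul_anticomm i j (Some a)) Z7) Z7) Z7 by vm_compute.
move=> /all_Z7P/(_ i)/all_Z7P/(_ j)/andP[anti0 /all_Z7P anti].
by case: a.
Qed.

Lemma join_line a : (- join a \in line_offsets) && (a - join a \in line_offsets).
Proof. by move: a; apply: (elimT (all_Z7P _)); vm_compute. Qed.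

Lemma third_line_offset a : third a - join a \in line_offsets.
Proof. by move: a; apply: (elimT (all_Z7P _)); vm_compute. Qed.

Lemma third_neq a : (a != 0) ==> (third a != 0) && (third a != a).
Proof. by move: a; apply: (elimT (all_Z7P _)); vm_compute. Qed.

Lemma third_uniq a b :
  [&& a != 0, b != 0, b != a & b - join a \in line_offsets] ==> (b == third a).
Proof.
have: all (fun a => all (fun b =>
    [&& a != 0, b != 0, b != a & b - join a \in line_offsets] ==> (b == third a))
  Z7) Z7 by vm_compute.
by move=> /all_Z7P/(_ a)/all_Z7P.
Qed.

(** Serves the dual use of [third]: with [b] the offset of a point on a line, it shows that a point
    on two lines also lies on their third line. *)
Lemma third_meet a b :
  [&& a != 0, b \in line_offsets & a + b \in line_offsets] ==>
  (third a + b \in line_offsets).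
Proof.
have: all (fun a => all (fun b =>
    [&& a != 0, b \in line_offsets & a + b \in line_offsets] ==>
    (third a + b \in line_offsets)) Z7) Z7 by vm_compute.
by move=> /all_Z7P/(_ a)/all_Z7P.
Qed.

(* The pairs (pt 0, ln (- d)) and (pt a, ln (a - d')), cases (1) to (4) in this
   order. *)
Definition comm_check (d a d' : 'Z_7) : bool :=
  let Y := comm_comb (X_comb 0 (- d)) (X_comb a (a - d')) in
  if a == 0 then eq_comb Y [::]
  else if - d == a - d' then
    eq_comb Y (scale_comb (2 * sgn a) (X_comb (third a) (join a)))
  else if (d' - a \in line_offsets) || (a + d \in line_offsets) then
    eq_comb Y (scale_comb (- sgn a) (X_comb (third a) (join a)))
  else eq_comb Y (scale_comb (- sgn a)
                    (X_comb (third a) (- d - third (d' - a - d)))).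

(** With the first point at the origin only 3 * 3 * 7 configurations remain, each a comparison of
    integer coefficients. *)
Lemma comm_checkP d a d' :
  d \in line_offsets -> d' \in line_offsets -> comm_check d a d'.
Proof.
have /allP H: all (fun d => all (fun d' =>
    all (fun a => comm_check d a d') Z7) line_offsets) line_offsets.
  by vm_compute.
by move=> /H/allP{}H /H/all_Z7P.
Qed.

(** * From the Clifford relations to the brackets of so(7) *)

Section CliffordRelations.

Variables (F : fieldType) (T : finType) (L : 'Z_7 -> 'End(octonion F T)).

Hypothesis two_neq0 : (2%:R : F) != 0.
Hypothesis L_anticomm : forall i j x,
  L i (L j x) + L j (L i x) = - ((2 * (i == j))%:R *: x).

(** The family [L] is left abstract so that translates of the left multiplications can be
    substituted for it. *)
Definition spin (i j : 'Z_7) : 'End(octonion F T) :=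
  (4%:R : F)^-1 *: lie_bracket (L i) (L j).

Definition spin_comb (s : lin_comb) : 'End(octonion F T) :=
  \sum_(t <- s) (t.1%:~R : F) *: spin t.2.1 t.2.2.

Lemma lie_bracketDl (f g h : 'End(octonion F T)) :
  lie_bracket (f + g) h = lie_bracket f h + lie_bracket g h.
Proof. by rewrite /lie_bracket comp_lfunDl comp_lfunDr opprD addrACA. Qed.

Lemma lie_bracketC (f g : 'End(octonion F T)) :
  lie_bracket f g = - lie_bracket g f.
Proof. by rewrite /lie_bracket opprB. Qed.

Lemma lie_bracketDr (f g h : 'End(octonion F T)) :
  lie_bracket f (g + h) = lie_bracket f g + lie_bracket f h.
Proof.
by rewrite lie_bracketC lie_bracketDl opprD -!(lie_bracketC f).
Qed.

Lemma lie_bracketZl k (f g : 'End(octonion F T)) :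
  lie_bracket (k *: f) g = k *: lie_bracket f g.
Proof. by rewrite /lie_bracket -comp_lfunZl -comp_lfunZr scalerBr. Qed.

Lemma lie_bracketZr k (f g : 'End(octonion F T)) :
  lie_bracket f (k *: g) = k *: lie_bracket f g.
Proof. by rewrite lie_bracketC lie_bracketZl -scalerN -lie_bracketC. Qed.

Lemma lie_bracket_suml (I : Type) (s : seq I) f (h : 'End(octonion F T)) :
  lie_bracket (\sum_(t <- s) f t) h = \sum_(t <- s) lie_bracket (f t) h.
Proof.
elim: s => [|t s IHs]; last by rewrite !big_cons lie_bracketDl IHs.
by rewrite !big_nil -[X in lie_bracket X](scale0r 0) lie_bracketZl scale0r.
Qed.

Lemma lie_bracket_sumr (I : Type) (s : seq I) f (h : 'End(octonion F T)) :
  lie_bracket h (\sum_(t <- s) f t) = \sum_(t <- s) lie_bracket h (f t).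
Proof.
rewrite lie_bracketC lie_bracket_suml -sumrN.
by apply: eq_bigr => t _; rewrite -lie_bracketC.
Qed.

(** This form says that bracketing with [f] is a derivation, which reduces [spin_comm] to
    [spin_L]. *)
Lemma jacobi (f g h : 'End(octonion F T)) :
  lie_bracket f (lie_bracket g h) =
  lie_bracket (lie_bracket f g) h + lie_bracket g (lie_bracket f h).
Proof.
apply/lfunP => x; rewrite add_lfunE !lie_bracketE !linearB /= !opprK.
by rewrite [RHS](AC (2*2*(2*2)) ((1*7*(6*4))*((5*2)*(8*3))))/= !subrr !addr0.
Qed.

Lemma L_swap i j x :
  L i (L j x) = - L j (L i x) - (2 * (i == j))%:R *: x.
Proof. by rewrite -L_anticomm addrCA addNr addr0. Qed.

(** Moving [L k] to the left past two factors changes the sign twice, so the cubic terms cancel and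
    only the corrections of [L_swap] remain. *)
Lemma lie_bracket_L i j k :
  lie_bracket (lie_bracket (L i) (L j)) (L k) =
  (4 * (i == k))%:R *: L j - (4 * (j == k))%:R *: L i.
Proof.
apply/lfunP => x; rewrite !lie_bracketE add_lfunE opp_lfunE !scale_lfunE.
rewrite linearB /= (L_swap j k x) (L_swap i k x) !linearB /= !linearN !linearZ /=.
rewrite (L_swap i k) (L_swap j k) (mulnDl 2 2 (i == k)) (mulnDl 2 2 (j == k)).
rewrite !natrD !scalerDl !scalerN.
move: (L k _) (L k _) (_ *: L j x) (_ *: L i x) => a b c d.
rewrite !opprD !opprK [LHS](AC (3*3*2) (2*6*(3*5)*((1*7)*(4*8))))/=.
by rewrite subrr addNr !addr0.
Qed.

Lemma four_neq0 : (4%:R : F) != 0.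
Proof. by rewrite (natrM _ 2 2) mulf_neq0. Qed.

(** The factor 1/4 normalizes the action on the [L k] to that of an elementary skew-symmetric
    matrix. *)
Lemma spin_L i j k :
  lie_bracket (spin i j) (L k) = (i == k)%:R *: L j - (j == k)%:R *: L i.
Proof.
by rewrite lie_bracketZl lie_bracket_L scalerBr !scalerA !natrM !mulKf ?four_neq0.
Qed.

Lemma spin_comm i j k l :
  lie_bracket (spin i j) (spin k l) =
    (i == k)%:R *: spin j l - (j == k)%:R *: spin i l +
    ((i == l)%:R *: spin k j - (j == l)%:R *: spin k i).
Proof.
rewrite {2}/spin lie_bracketZr jacobi !spin_L.
rewrite -!scaleNr lie_bracketDl lie_bracketDr !lie_bracketZl !lie_bracketZr.
rewrite /spin; do 4 move: (lie_bracket _ _) => ?.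
by rewrite !scalerDr !scalerA ![4%:R^-1 * _]mulrC.
Qed.

Lemma spin_anti i j : spin i j = - spin j i.
Proof. by rewrite /spin lie_bracketC scalerN. Qed.

Lemma spin_comb_nil : spin_comb [::] = 0.
Proof. exact: big_nil. Qed.

Lemma spin_comb_scale c s : spin_comb (scale_comb c s) = c%:~R *: spin_comb s.
Proof.
rewrite /spin_comb big_map scaler_sumr; apply: eq_bigr => t _.
by rewrite /= intrM -scalerA.
Qed.

Lemma spin_comb_comm s t :
  spin_comb (comm_comb s t) = lie_bracket (spin_comb s) (spin_comb t).
Proof.
rewrite /spin_comb big_flatten big_allpairs_dep lie_bracket_suml.
apply: eq_bigr => -[c [i j]] _; rewrite lie_bracket_sumr.
apply: eq_bigr => -[d [k l]] _; rewrite /comm_term !big_cons big_nil /= addr0.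
rewrite lie_bracketZl lie_bracketZr spin_comm -!scaleNr !scalerDr !scalerA -!addrA.
by rewrite !(mulNr, mulrN, mulrNz, intrM).
Qed.

Lemma sum_delta k l :
  \sum_i \sum_j ((k, l) == (i, j))%:~R *: spin i j = spin k l.
Proof.
rewrite pair_bigA (bigD1 (k, l)) //= eqxx scale1r big1 ?addr0 // => -[i j] /=.
by rewrite eq_sym => /negPf->; rewrite scale0r.
Qed.

(** The antisymmetrized coefficients count each term at both (k, l) and (l, k); by [spin_anti] the
    two contributions agree, whence the factor 2. *)
Lemma sum_coef s :
  \sum_i \sum_j (coef s i j)%:~R *: spin i j = 2%:R *: spin_comb s.
Proof.
elim: s => [|[c [k l]] s IHs].
  rewrite spin_comb_nil scaler0 big1 // => i _.
  by rewrite big1 // => j _; rewrite scale0r.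
rewrite /spin_comb big_cons scalerDr -IHs /=.
under eq_bigr do under eq_bigr do
  rewrite intrD scalerDl intrM rmorphB /= -scalerA scalerBl scalerBr.
under eq_bigr do rewrite big_split sumrB -!scaler_sumr /=.
rewrite big_split sumrB -!scaler_sumr !sum_delta /= (spin_anti l k) scalerN opprK.
by rewrite -mulr2n scaler_nat.
Qed.

Lemma eq_combP s t : eq_comb s t -> spin_comb s = spin_comb t.
Proof.
(* Characteristic not 2 allows the factor 2 of [sum_coef] to be cancelled. *)
move=> /all_Z7P eq_st; apply: (scalerI two_neq0); rewrite -!sum_coef.
apply: eq_bigr => i _; apply: eq_bigr => j _; congr (_%:~R *: _).
by apply/eqP; move: (eq_st i) => /all_Z7P.
Qed.

End CliffordRelations.

(** * The Fano plane in coordinates from Z/7 *)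

Section FanoOctonions.

Variables (T : finType) (lines : {set {set T}}) (tau : {perm T}) (P0 : T).

Hypothesis fanoT : fano_plane lines.
Hypothesis tau_order : #[tau]%g = 7%N.
Hypothesis type013 : lines = [set ln tau P0 i | i : 'Z_7].

Local Notation pt := (pt tau P0).
Local Notation ln := (ln tau P0).
Local Notation idx := (idx tau P0).

Lemma ptD i a : pt (i + a) = ((tau ^+ a)%g) (pt i).
Proof.
by rewrite /Defs.pt -permM -expgD -(expg_mod_order tau (addn i a)) tau_order.
Qed.

Lemma ln_in_lines i : ln i \in lines.
Proof. by rewrite type013 imset_f. Qed.

Lemma ln_inj : injective ln.
Proof.
have [_ card_lines _ _] := fanoT.
have /imset_injP injl: #|[set ln i | i : 'Z_7]| == #|'Z_7|.
  by rewrite -type013 card_lines card_ord.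
by move=> i j; apply: injl; rewrite inE.
Qed.

(** A line [ln i] consists of translates of [pt i] under powers of [tau], so equal points give equal
    lines, and the seven lines are distinct by counting. *)
Lemma pt_inj : injective pt.
Proof. by move=> i j eq_ij; apply: ln_inj; rewrite /Defs.ln !ptD eq_ij. Qed.

Lemma pt_onto P : exists i, P = pt i.
Proof.
have [card_T _ _ _] := fanoT.
have le_card : (#|T| <= #|'Z_7|)%N by rewrite card_T card_ord.
exact/codomP/(inj_card_onto pt_inj le_card).
Qed.

Lemma idx_pt i : idx (pt i) = i.
Proof.
rewrite /Defs.idx; case: pickP => [j /eqP/pt_inj //|/(_ i)].
by rewrite eqxx.
Qed.

Lemma eps_pt F i a : eps tau P0 F (pt i) (pt (i + a)) = (sgn a)%:~R.
Proof. by rewrite /eps !idx_pt addrC addKr /sgn; case: ifP. Qed.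

Lemma pt_in_ln i j : (pt i \in ln j) = (i - j \in line_offsets).
Proof.
by rewrite !inE !(inj_eq pt_inj) !subr_eq add0r ![_ + j]addrC orbA.
Qed.

Lemma incidentP P D : incident lines P D ->
  exists i d, [/\ P = pt i, D = ln (i - d) & d \in line_offsets].
Proof.
rewrite /incident type013 => /andP[/imsetP[j _ ->]]; have [i ->] := pt_onto P.
by exists i, (i - j); rewrite -pt_in_ln opprB addrC subrK.
Qed.

Lemma line_through_eq P Q D :
  D \in lines -> P \in D -> Q \in D -> P != Q -> line_through lines P Q = D.
Proof.
have [_ _ _ uniq_line] := fanoT => linD PD QD /uniq_line[E [_ uniqE]].
rewrite /line_through; case: pickP => [E' /and3P[linE' PE' QE']|/(_ D)].
  by rewrite /= -(uniqE D) // -(uniqE E').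
by rewrite linD PD QD.
Qed.

Lemma line_through_pt i a :
  a != 0 -> line_through lines (pt i) (pt (i + a)) = ln (i + join a).
Proof.
move=> a_neq0; have /andP[ja0 ja1] := join_line a.
apply: line_through_eq; rewrite ?ln_in_lines ?pt_in_ln ?(inj_eq pt_inj) //.
- by rewrite opprD addNKr.
- by rewrite opprD addrACA subrr add0r.
- by rewrite -[X in X == _]addr0 (inj_eq (addrI i)) eq_sym.
Qed.

Lemma third_point_pt i a :
  a != 0 -> third_point lines (pt i) (pt (i + a)) = pt (i + third a).
Proof.
move=> a_neq0; have /andP[ta0 ta1] := implyP (third_neq a) a_neq0.
have pt_eqD b c : (pt (i + b) == pt (i + c)) = (b == c).
  by rewrite (inj_eq pt_inj) (inj_eq (addrI i)).
have pt_eq0 b : (pt (i + b) == pt i) = (b == 0) by rewrite -(pt_eqD b) addr0.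
rewrite /third_point line_through_pt //.
case: pickP => [R|/(_ (pt (i + third a)))] /=; last first.
  rewrite pt_in_ln opprD addrACA subrr add0r third_line_offset.
  by rewrite pt_eqD pt_eq0 ta0 ta1.
(* Any point that is picked is rewritten with its offset [k - i] from [pt i], which [third_uniq]
   then determines. *)
have [k ->] := pt_onto R; rewrite -(addrNK i k) addrC pt_eqD pt_eq0 pt_in_ln.
rewrite opprD addrACA subrr add0r => /and3P[on_k k0 ka].
have third_k := introT and4P (And4 a_neq0 k0 ka on_k).
by have /eqP-> := implyP (third_uniq a (k - i)) third_k.
Qed.

(* Exchanging points with lines and negating the indices preserves incidence,
   so [third] also computes third lines. *)
Lemma third_line_ln j b :
  b != 0 -> third_line lines (ln j) (ln (j - b)) = ln (j - third b).
Proof.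
move=> b_neq0; have /andP[tb0 tb1] := implyP (third_neq b) b_neq0.
have ln_eqB c d : (ln (j - c) == ln (j - d)) = (c == d).
  by rewrite (inj_eq ln_inj) (inj_eq (addrI j)) eqr_opp.
have ln_eq0 c : (ln (j - c) == ln j) = (c == 0) by rewrite -(ln_eqB c) subr0.
(* The common point of the two lines is [pt (j - join b)]: by [join_line] the criterion holds for
   [c = 0] and for [c = b]. *)
have on_common c : (pt (j - join b) \in ln (j - c)) = (c - join b \in line_offsets).
  by rewrite pt_in_ln opprB addrC addrA subrK.
have common l : ln j :&: ln (j - b) \subset ln l -> pt (j - join b) \in ln l.
  move=> /subsetP; apply; rewrite inE on_common -[in ln j](subr0 j) on_common.
  by rewrite add0r join_line.
rewrite /third_line; case: pickP => [E /andP[]|/(_ (ln (j - third b)))] /=.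
  rewrite type013 => /imsetP[l _ ->]; rewrite -(subKr j l) ln_eqB ln_eq0.
  move=> /and3P[l0 lb /common]; rewrite on_common => on_l.
  have third_l := introT and4P (And4 b_neq0 l0 lb on_l).
  by have /eqP-> := implyP (third_uniq b (j - l)) third_l.
rewrite ln_in_lines ln_eq0 ln_eqB tb0 tb1 /= => /negbT/negP[].
apply/subsetP => P; have [i ->] := pt_onto P.
have offset c : i - (j - c) = c + (i - j) by rewrite opprB addrCA.
rewrite inE !pt_in_ln !offset => /andP[on_j on_jb].
by apply: (implyP (third_meet b (i - j))); rewrite b_neq0 on_j.
Qed.

(** * Left multiplications of the octonions *)

Variable F : fieldType.

Let L (i : 'Z_7) : 'End(octonion F T) := lmult lines tau P0 (oct_e F (pt i)).

Let signed_basis (a : int * option 'Z_7) : octonion F T :=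
  a.1%:~R *: oct_basis F (omap pt a.2).

Lemma L_signed_basis i a : L i (signed_basis a) = signed_basis (emul i a).
Proof.
case: a => c [j|]; rewrite linearZ /= lmultE oct_mul_basis /signed_basis //=.
rewrite (inj_eq pt_inj) /emul /=.
case: eqP => [_|/eqP ij] /=; first by rewrite mulrNz scaleNr scalerN.
have ji : j - i != 0 by rewrite subr_eq0 eq_sym.
have -> : pt j = pt (i + (j - i)) by rewrite addrC subrK.
by rewrite eps_pt // third_point_pt // scalerA -intrM.
Qed.

Lemma oct_basisE (x : octonion F T) : x = \sum_a x a *: oct_basis F a.
Proof.
apply/ffunP => b; rewrite sum_ffunE (bigD1 b) //= big1 ?addr0 => [|a /negPf ab].
  by rewrite !ffunE eqxx /GRing.scale /= mulr1.
by rewrite !ffunE ab scaler0.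
Qed.

(** By linearity it suffices to test basis vectors, where [emul_anticommP] decides. *)
Lemma L_anticomm i j x :
  L i (L j x) + L j (L i x) = - ((2 * (i == j))%:R *: x).
Proof.
rewrite [x]oct_basisE !linear_sum -big_split; apply: eq_bigr => a _ /=.
rewrite !linearZ /= -scalerDr [RHS]scalerA [_ * x a]mulrC -[RHS]scalerA scalerN.
congr (_ *: _).
have [b ->] : exists b, a = omap pt b.
  case: a => [P|]; last by exists None.
  by have [k ->] := pt_onto P; exists (Some k).
have -> : oct_basis F (omap pt b) = signed_basis (1, b).
  by rewrite /signed_basis scale1r.
rewrite !L_signed_basis.
have /andP[] := emul_anticommP i j b.
case: (i =P j) => [<- _ /eqP-> | _ /eqP eq2 /eqP eq1].
  rewrite /signed_basis /= -!scaleNr -scalerDl scalerA.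
  congr (_ *: _); by rewrite mulrNz mulr1 -opprD.
by rewrite /signed_basis eq2 eq1 -scalerDl mulrNz addNr muln0 scale0r scale0r oppr0.
Qed.

Let Lshift i k := L (i + k).

(** The translation by [i] is absorbed into the family [Lshift], leaving a combination that depends
    only on the offsets. *)
Lemma X_op_pt_ln i a j :
  X_op F lines tau P0 (pt (i + a)) (ln (i + j)) =
    spin_comb (Lshift i) (X_comb a j).
Proof.
rewrite /X_op idx_pt // /X_comb -!addrA !(inj_eq ln_inj).
rewrite !(inj_eq (addrI i)).
by do ! case: ifP => _; rewrite /spin_comb ?big_cons big_nil ?addr0 //=
  !scale1r ?scaleN1r -?scaleNr.
Qed.

End FanoOctonions.

(** * Reduction of the four cases to the finite check *)

Theorem theorem3p18 (F : fieldType) (char_F : 2%N \notin [pchar F])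
    (T : finType) (lines : {set {set T}}) (tau : {perm T}) (P0 : T)
    (fanoT : fano_plane lines)
    (tau_aut : fano_automorphism lines tau)
    (tau_order : #[tau]%g = 7%N)
    (type013 : lines = [set ln tau P0 i | i : 'Z_7])
    (P P' : T) (D D' : {set T})
    (incPD : incident lines P D) (incPD' : incident lines P' D') :
  let X := X_op F lines tau P0 in
  let epsilon := eps tau P0 F in
  [/\ P = P' -> D <> D' -> lie_bracket (X P D) (X P' D') = 0,
      P <> P' -> D = D' ->
        lie_bracket (X P D) (X P' D') =
          (2%:R * epsilon P P') *:
            X (third_point lines P P') (line_through lines P P'),
      P <> P' -> D <> D' -> P \in D' \/ P' \in D ->
        lie_bracket (X P D) (X P' D') =
          (- epsilon P P') *:
            X (third_point lines P P') (line_through lines P P')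
    & P <> P' -> D <> D' -> P \notin D' -> P' \notin D ->
        lie_bracket (X P D) (X P' D') =
          (- epsilon P P') *:
            X (third_point lines P P') (third_line lines D D')].
Proof.
have two_neq0 : (2%:R : F) != 0 by move: char_F; rewrite inE.
have ptE := inj_eq (pt_inj fanoT tau_order type013).
have lnE := inj_eq (ln_inj fanoT type013).
have addE i := inj_eq (addrI i).
have [i [d [-> -> d_off]]] := incidentP fanoT tau_order type013 incPD.
have [i' [d' [-> -> d'_off]]] := incidentP fanoT tau_order type013 incPD'.
(* The first point becomes the origin: from here on all indices are offsets from [i]. *)
have -> : i' = i + (i' - i) by rewrite addrC subrK.
move: {i'}(i' - i) => a X epsilon.
set L := fun k : 'Z_7 => lmult lines tau P0 (oct_e F (pt tau P0 (i + k))).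
have L_anti j k x : L j (L k x) + L k (L j x) = - ((2 * (j == k))%:R *: x).
  by rewrite /L (L_anticomm fanoT tau_order type013) addE.
have X_E b j : X (pt tau P0 (i + b)) (ln tau P0 (i + j)) = spin_comb L (X_comb b j).
  exact: (X_op_pt_ln fanoT tau_order type013).
have XPD : X (pt tau P0 i) (ln tau P0 (i - d)) = spin_comb L (X_comb 0 (- d)).
  by rewrite -X_E addr0.
rewrite -addrA XPD X_E -(spin_comb_comm two_neq0 L_anti).
rewrite !(pt_in_ln fanoT tau_order type013).
have -> : i - (i + (a - d')) = d' - a by rewrite opprD addNKr opprB.
have -> : i + a - (i - d) = a + d by rewrite opprD addrACA subrr add0r opprK.
have := comm_checkP a d_off d'_off; rewrite /comm_check.
have eqV := eq_combP L two_neq0.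
have [-> | a_neq0] := eqVneq a 0.
  by move=> /eqV->; rewrite addr0 spin_comb_nil; split.
have P_neq : pt tau P0 i <> pt tau P0 (i + a).
  by apply/eqP; rewrite ptE -{1}[i]addr0 addE eq_sym.
rewrite /epsilon (eps_pt fanoT tau_order type013).
rewrite (third_point_pt fanoT tau_order type013) //.
rewrite (line_through_pt fanoT tau_order type013) // X_E.
have [<- | off_neq] := eqVneq (- d) (a - d').
  by move=> /eqV->; rewrite spin_comb_scale intrM; split.
have D_neq : ln tau P0 (i - d) <> ln tau P0 (i + (a - d')).
  by apply/eqP; rewrite lnE addE.
case: ifP => [on /eqV-> | /negbT/norP[nPD' nP'D] /eqV->].
  rewrite spin_comb_scale mulrNz; split=> // _ _ /negPf nPD' /negPf nP'D.
  by rewrite nPD' nP'D in on.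
(* This is the index of [D] minus that of [D'], the nonzero shift required by [third_line_ln]. *)
have b_neq0 : d' - a - d != 0.
  by apply: contraNneq off_neq => b0; rewrite -subr_eq0 opprB addrC b0.
have -> : third_line lines (ln tau P0 (i - d)) (ln tau P0 (i + (a - d'))) =
    ln tau P0 (i + (- d - third (d' - a - d))).
  rewrite [i + (- d - _)]addrA -(third_line_ln fanoT tau_order type013) //.
  congr (third_line _ _ (ln _ _ _)).
  by rewrite -addrA !opprB addKr.
rewrite X_E spin_comb_scale mulrNz; split=> // _ _ [on | on].
  by rewrite on in nPD'.
by rewrite on in nP'D.
Qed.
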